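(* Let $(S,T,m,n)$ be a sesquilaw of a monad $T$ over a monad $S$ on the same category. Then there is a right action of its monad $TS$ on its magmad $ST$: a natural transformation $u_X\colon STTSX\to STX$ such that $$u_X\circ ST(\eta^{TS}_X)=\mathrm{id}_{STX}\qquad\text{and}\qquad u_X\circ ST(\mu^{TS}_X)=u_X\circ u_{TSX}\quad(\text{as maps }STTSTSX\to STX).$$ This action is defined by either of the following two composites, which are equal: $$u_X=n_X\circ T(\mu^S_X)\circ m_{SX}\circ S(\mu^T_{SX})=n_X\circ\mu^T_{SX}\circ TT(\mu^S_X)\circ T(m_{SX})\circ m_{TSX}.$$
   Context: For monads $(S,\mu^S,\eta^S)$ and $(T,\mu^T,\eta^T)$ on the same category: A distributive law of $S$ over $T$ is a natural transformation $m_X\colon STX\to TSX$ with $m_X\circ\mu^S_{TX}=T(\mu^S_X)\circ m_{SX}\circ S(m_X)$; $m_X\circ\eta^S_{TX}=T(\eta^S_X)$; $m_X\circ S(\mu^T_X)=\mu^T_{SX}\circ T(m_X)\circ m_{TX}$; $m_X\circ S(\eta^T_X)=\eta^T_{SX}$. An almost-distributive law of $T$ over $S$ is a natural transformation $n_X\colon TSX\to STX$ with $n_X\circ T(\mu^S_X)=\mu^S_{TX}\circ S(n_X)\circ n_{SX}$; $n_X\circ\eta^T_{SX}=S(\eta^T_X)$; $n_X\circ T(\eta^S_X)=\eta^S_{TX}$. A sesquilaw $(S,T,m,n)$ of $T$ over $S$ consists of a distributive law $m\colon ST\to TS$ and an almost-distributive law $n\colon TS\to ST$ such that (1) $n_X\circ\mu^T_{SX}\circ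 T(m_X)=S(\mu^T_X)\circ n_{TX}$ as maps $TSTX\to STX$, and (2) $n_X\circ m_X=\mathrm{id}_{STX}$. The monad of the sesquilaw is $TS$ with $\mu^{TS}_X=\mu^T_{SX}\circ TT(\mu^S_X)\circ T(m_{SX})$ and $\eta^{TS}_X=\eta^T_{SX}\circ\eta^S_X$. The magmad (monad without associativity: an endofunctor with natural $\eta,\mu$ satisfying both unit laws) of the sesquilaw is $ST$ with multiplication $\mu^S_{TX}\circ SS(\mu^T_X)\circ S(n_{TX})$ and unit $S(\eta^T_X)\circ\eta^S_X$. *)

(* Defs.v *)
From Corelib Require Import ssreflect.

Set Implicit Arguments.
Unset Strict Implicit.
Unset Printing Implicit Defensive.

Declare Scope cat_scope.
Delimit Scope cat_scope with cat.
Local Open Scope cat_scope.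

Record Category := {
  obj :> Type;
  hom : obj -> obj -> Type;
  idm : forall X, hom X X;
  comp : forall X Y Z, hom Y Z -> hom X Y -> hom X Z;
  comp_idl : forall X Y (f : hom X Y), comp (idm Y) f = f;
  comp_idr : forall X Y (f : hom X Y), comp f (idm X) = f;
  comp_assoc : forall X Y Z W (h : hom Z W) (g : hom Y Z) (f : hom X Y),
    comp h (comp g f) = comp (comp h g) f
}.
Arguments hom {c} _ _.
Arguments idm {c} X.
Arguments comp {c X Y Z} _ _.

Notation "g ∘ f" := (comp g f)
  (at level 40, left associativity) : cat_scope.

Record Functor (C D : Category) := {
  fobj :> C -> D;
  fmap : forall X Y : C, hom X Y -> hom (fobj X) (fobj Y);
  fmap_id : forall X : C, fmap (idm X) = idm (fobj X);
  fmap_comp : forall (X Y Z : C) (g : hom Y Z) (f : hom X Y),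
    fmap (g ∘ f) = fmap g ∘ fmap f
}.
Arguments fmap {C D} f0 {X Y} _.

Definition Fid (C : Category) : Functor C C :=
  @Build_Functor C C (fun X => X) (fun _ _ f => f)
    (fun _ => eq_refl) (fun _ _ _ _ _ => eq_refl).

Definition Fcomp (C D E : Category) (G : Functor D E) (F : Functor C D) :
  Functor C E.
Proof.
refine (@Build_Functor C E (fun X => G (F X))
          (fun X Y f => fmap G (fmap F f)) _ _).
- abstract (by move=> X; rewrite !fmap_id).
- abstract (by move=> X Y Z g f; rewrite !fmap_comp).
Defined.

Notation "G ∘F F" := (Fcomp G F)
  (at level 40, left associativity) : cat_scope.

Record NatTrans (C D : Category) (F G : Functor C D) := {
  nt :> forall X : C, hom (F X) (G X);
  naturality : forall (X Y : C) (f : hom X Y),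
    nt Y ∘ fmap F f = fmap G f ∘ nt X
}.

Record Magmad (C : Category) := {
  magmad_functor :> Functor C C;
  magmad_unit : NatTrans (Fid C) magmad_functor;
  magmad_mult : NatTrans (magmad_functor ∘F magmad_functor) magmad_functor;
  magmad_unit_l : forall X : C,
    magmad_mult X ∘ magmad_unit (magmad_functor X) = idm (magmad_functor X);
  magmad_unit_r : forall X : C,
    magmad_mult X ∘ fmap magmad_functor (magmad_unit X)
    = idm (magmad_functor X)
}.

Record Monad (C : Category) := {
  monad_functor :> Functor C C;
  eta : NatTrans (Fid C) monad_functor;
  mu : NatTrans (monad_functor ∘F monad_functor) monad_functor;
  monad_unit_l : forall X : C,
    mu X ∘ eta (monad_functor X) = idm (monad_functor X);
  monad_unit_r : forall X : C,
    mu X ∘ fmap monad_functor (eta X) = idm (monad_functor X);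
  monad_assoc : forall X : C,
    mu X ∘ fmap monad_functor (mu X) = mu X ∘ mu (monad_functor X)
}.
Arguments eta {C} m.
Arguments mu {C} m.

Record DistributiveLaw (C : Category) (S T : Monad C) := {
  dl :> NatTrans (S ∘F T) (T ∘F S);
  dl_muS : forall X : C,
    dl X ∘ mu S (T X) = fmap T (mu S X) ∘ dl (S X) ∘ fmap S (dl X);
  dl_etaS : forall X : C,
    dl X ∘ eta S (T X) = fmap T (eta S X);
  dl_muT : forall X : C,
    dl X ∘ fmap S (mu T X) = mu T (S X) ∘ fmap T (dl X) ∘ dl (T X);
  dl_etaT : forall X : C,
    dl X ∘ fmap S (eta T X) = eta T (S X)
}.

Record AlmostDistributiveLaw (C : Category) (T S : Monad C) := {
  adl :> NatTrans (T ∘F S) (S ∘F T);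
  adl_muS : forall X : C,
    adl X ∘ fmap T (mu S X) = mu S (T X) ∘ fmap S (adl X) ∘ adl (S X);
  adl_etaT : forall X : C,
    adl X ∘ eta T (S X) = fmap S (eta T X);
  adl_etaS : forall X : C,
    adl X ∘ fmap T (eta S X) = eta S (T X)
}.

Record Sesquilaw (C : Category) (S T : Monad C) := {
  sq_m : DistributiveLaw S T;
  sq_n : AlmostDistributiveLaw T S;
  sq_mult : forall X : C,
    sq_n X ∘ mu T (S X) ∘ fmap T (sq_m X) = fmap S (mu T X) ∘ sq_n (T X);
  sq_section : forall X : C,
    sq_n X ∘ sq_m X = idm (S (T X))
}.

(** Naturality and monad laws with the functor compositions unfolded. *)
Section Unfolded.
Variables (C : Category) (S T : Monad C).

Lemma eta_nat (X Y : C) (f : hom X Y) : eta T Y ∘ f = fmap T f ∘ eta T X.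
Proof. exact: (naturality (eta T) f). Qed.

Lemma mu_nat (X Y : C) (f : hom X Y) :
  mu T Y ∘ fmap T (fmap T f) = fmap T f ∘ mu T X.
Proof. exact: (naturality (mu T) f). Qed.

Lemma dl_nat (m : DistributiveLaw S T) (X Y : C) (f : hom X Y) :
  m Y ∘ fmap S (fmap T f) = fmap T (fmap S f) ∘ m X.
Proof. exact: (naturality m f). Qed.

Lemma adl_nat (n : AlmostDistributiveLaw T S) (X Y : C) (f : hom X Y) :
  n Y ∘ fmap T (fmap S f) = fmap S (fmap T f) ∘ n X.
Proof. exact: (naturality n f). Qed.

End Unfolded.

Section CompositeMonad.
Variables (C : Category) (S T : Monad C) (m : DistributiveLaw S T).

Definition TS_unit_fun (X : C) : hom X (T (S X)) := eta T (S X) ∘ eta S X.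

Definition TS_mult_fun (X : C) : hom (T (S (T (S X)))) (T (S X)) :=
  mu T (S X) ∘ fmap T (fmap T (mu S X)) ∘ fmap T (m (S X)).

Lemma TS_unit_nat (X Y : C) (f : hom X Y) :
  TS_unit_fun Y ∘ f = fmap T (fmap S f) ∘ TS_unit_fun X.
Proof.
rewrite /TS_unit_fun -comp_assoc (eta_nat S) (comp_assoc _ (fmap S f)).
by rewrite (eta_nat T (fmap S f)) comp_assoc.
Qed.

Lemma TS_mult_nat (X Y : C) (f : hom X Y) :
  TS_mult_fun Y ∘ fmap T (fmap S (fmap T (fmap S f)))
  = fmap T (fmap S f) ∘ TS_mult_fun X.
Proof.
rewrite /TS_mult_fun -!comp_assoc -fmap_comp (dl_nat m (fmap S f)) fmap_comp.
rewrite (comp_assoc (fmap T (fmap T (mu S Y)))) -!fmap_comp mu_nat !fmap_comp.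
by rewrite !comp_assoc (mu_nat T (fmap S f)).
Qed.

Lemma TS_unit_l (X : C) :
  TS_mult_fun X ∘ TS_unit_fun (T (S X)) = idm (T (S X)).
Proof.
rewrite /TS_mult_fun /TS_unit_fun -!comp_assoc.
rewrite (comp_assoc (fmap T (m (S X)))) -(eta_nat T (m (S X))) -comp_assoc dl_etaS.
rewrite (comp_assoc (fmap T (fmap T (mu S X)))) -(eta_nat T (fmap T (mu S X))) -comp_assoc.
rewrite -fmap_comp monad_unit_l fmap_id comp_idr.
exact: monad_unit_l.
Qed.

Lemma TS_unit_r (X : C) :
  TS_mult_fun X ∘ fmap T (fmap S (TS_unit_fun X)) = idm (T (S X)).
Proof.
rewrite /TS_mult_fun /TS_unit_fun -!comp_assoc -!fmap_comp.
rewrite (fmap_comp S) (comp_assoc (m (S X))) dl_etaT.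
rewrite (comp_assoc (fmap T (mu S X))) -(eta_nat T (mu S X)) -comp_assoc.
by rewrite monad_unit_r comp_idr monad_unit_r.
Qed.

Lemma TS_assoc (X : C) :
  TS_mult_fun X ∘ fmap T (fmap S (TS_mult_fun X))
  = TS_mult_fun X ∘ TS_mult_fun (T (S X)).
Proof.
have E : fmap T (mu S X) ∘ (m (S X) ∘ fmap S (TS_mult_fun X))
    = mu T (S X)
      ∘ (fmap T (fmap T (mu S X) ∘ m (S X) ∘ mu S (T (S X)))
         ∘ m (S (T (S X)))).
  rewrite /TS_mult_fun !(fmap_comp S) -!comp_assoc.
  rewrite (comp_assoc (m (S X))) dl_muT -!comp_assoc.
  rewrite -!(fmap_comp S) -(fmap_comp T).
  have -> : m (T (S X)) ∘ fmap S (fmap T (fmap T (mu S X) ∘ m (S X)))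
      = fmap T (fmap S (fmap T (mu S X) ∘ m (S X))) ∘ m (S (T (S X))).
    exact: dl_nat.
  rewrite (comp_assoc _ (mu T (S (S X)))) -(mu_nat T (mu S X)) -!comp_assoc; congr (_ ∘ _).
  rewrite !(comp_assoc (fmap T _)) -(fmap_comp T) comp_assoc -(fmap_comp T).
  apply: (f_equal (fun h => fmap T h ∘ _)).
  rewrite -!comp_assoc dl_muS (fmap_comp S) (comp_assoc (m (S X))).
  rewrite (dl_nat m (mu S X)) !comp_assoc.
  by rewrite -!(fmap_comp T) monad_assoc.
rewrite {1}/TS_mult_fun -!comp_assoc -!(fmap_comp T) E.
rewrite (fmap_comp T (mu T _)) (comp_assoc (mu T (S X)) (fmap T (mu T (S X)))).
rewrite monad_assoc -comp_assoc.
rewrite (comp_assoc (fmap T (fmap T (mu S X)))) -(fmap_comp T).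
rewrite /TS_mult_fun -!(comp_assoc (mu T _)) (comp_assoc (fmap T _) (mu T _)).
rewrite -(mu_nat T (fmap T (mu S X) ∘ m (S X))) -!(comp_assoc (mu T _)).
by rewrite -!(fmap_comp T) !comp_assoc -!(fmap_comp T).
Qed.

Definition TS_unit : NatTrans (Fid C) (T ∘F S) :=
  @Build_NatTrans C C (Fid C) (T ∘F S) TS_unit_fun TS_unit_nat.

Definition TS_mult : NatTrans ((T ∘F S) ∘F (T ∘F S)) (T ∘F S) :=
  @Build_NatTrans C C ((T ∘F S) ∘F (T ∘F S)) (T ∘F S) TS_mult_fun TS_mult_nat.

Definition TS_monad : Monad C :=
  @Build_Monad C (T ∘F S) TS_unit TS_mult TS_unit_l TS_unit_r TS_assoc.

End CompositeMonad.

Section CompositeMagmad.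
Variables (C : Category) (S T : Monad C) (n : AlmostDistributiveLaw T S).

Definition ST_unit_fun (X : C) : hom X (S (T X)) :=
  fmap S (eta T X) ∘ eta S X.

Definition ST_mult_fun (X : C) : hom (S (T (S (T X)))) (S (T X)) :=
  mu S (T X) ∘ fmap S (fmap S (mu T X)) ∘ fmap S (n (T X)).

Lemma ST_unit_nat (X Y : C) (f : hom X Y) :
  ST_unit_fun Y ∘ f = fmap S (fmap T f) ∘ ST_unit_fun X.
Proof.
rewrite /ST_unit_fun -comp_assoc (eta_nat S) !comp_assoc -!fmap_comp.
by rewrite (eta_nat T).
Qed.

Lemma ST_mult_nat (X Y : C) (f : hom X Y) :
  ST_mult_fun Y ∘ fmap S (fmap T (fmap S (fmap T f)))
  = fmap S (fmap T f) ∘ ST_mult_fun X.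
Proof.
rewrite /ST_mult_fun -!comp_assoc -fmap_comp (adl_nat n (fmap T f)) fmap_comp.
rewrite (comp_assoc (fmap S (fmap S (mu T Y)))) -!fmap_comp mu_nat !fmap_comp.
by rewrite !comp_assoc (mu_nat S (fmap T f)).
Qed.

Lemma ST_unit_l (X : C) :
  ST_mult_fun X ∘ ST_unit_fun (S (T X)) = idm (S (T X)).
Proof.
rewrite /ST_mult_fun /ST_unit_fun -!comp_assoc.
rewrite (comp_assoc (fmap S (n (T X)))) -fmap_comp adl_etaT.
rewrite -(eta_nat S) (comp_assoc (fmap S (fmap S (mu T X)))) -(eta_nat S (fmap S (mu T X))) -comp_assoc.
rewrite -fmap_comp monad_unit_l fmap_id comp_idr.
exact: monad_unit_l.
Qed.

Lemma ST_unit_r (X : C) :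
  ST_mult_fun X ∘ fmap S (fmap T (ST_unit_fun X)) = idm (S (T X)).
Proof.
rewrite /ST_mult_fun /ST_unit_fun -!comp_assoc -!fmap_comp.
rewrite (fmap_comp T) (comp_assoc (n (T X))) (adl_nat n (eta T X)).
rewrite -comp_assoc adl_etaS comp_assoc -fmap_comp monad_unit_r fmap_id.
by rewrite comp_idl monad_unit_r.
Qed.

Definition ST_unit : NatTrans (Fid C) (S ∘F T) :=
  @Build_NatTrans C C (Fid C) (S ∘F T) ST_unit_fun ST_unit_nat.

Definition ST_mult : NatTrans ((S ∘F T) ∘F (S ∘F T)) (S ∘F T) :=
  @Build_NatTrans C C ((S ∘F T) ∘F (S ∘F T)) (S ∘F T) ST_mult_fun ST_mult_nat.

Definition ST_magmad : Magmad C :=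
  @Build_Magmad C (S ∘F T) ST_unit ST_mult ST_unit_l ST_unit_r.

End CompositeMagmad.

Definition sesquilaw_monad (C : Category) (S T : Monad C)
  (L : Sesquilaw S T) : Monad C := TS_monad (sq_m L).

Definition sesquilaw_magmad (C : Category) (S T : Monad C)
  (L : Sesquilaw S T) : Magmad C := ST_magmad (sq_n L).

(** A right action of a monad on a magmad only involves the underlying
    endofunctor of the latter. *)
Record RightAction (C : Category) (M : Monad C) (F : Magmad C) := {
  ract :> NatTrans (F ∘F M) F;
  ract_unit : forall X : C, ract X ∘ fmap F (eta M X) = idm (F X);
  ract_mult : forall X : C,
    ract X ∘ fmap F (mu M X) = ract X ∘ ract (M X)
}.

(* Main.v *)
From Corelib Require Import ssreflect.
Require Import Defs.
Local Open Scope cat_scope.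

(** Write m, n for the two laws of the sesquilaw and q for the multiplication
    of the monad TS.  The second formula for the action reads

      u_X = n_X ∘ q_X ∘ m_{TSX},

    so u is q, the regular right action of TS on itself, transported to ST along
    the section m : ST -> TS and its retraction n : TS -> ST.  In general a retract
    of a module is not a module; here it is, because the map n_X ∘ q_X does
    not distinguish an element of TSTSX from its image under the idempotent
    m_{TSX} ∘ n_{TSX} (lemma [absorb_idempotent]).  The reason is that
    n_X ∘ q_X factors through n_{TSX}: the compatibility of n with the
    multiplication of S, followed by the axiom [sq_mult], moves n
    from the end of the composite to its beginning (lemma
    [adl_TS_mult_factor]), and n ∘ m ∘ n = n because n ∘ m = id.

    Given this, with m natural and q associative,

      u_X ∘ ST q_X = n_X ∘ q_X ∘ TS q_X ∘ m
                   = n_X ∘ q_X ∘ q_{TSX} ∘ m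
                   = n_X ∘ q_X ∘ m_{TSX} ∘ n_{TSX} ∘ q_{TSX} ∘ m
                   = u_X ∘ u_{TSX},

    where m stands for m_{TSTSX}.  The unit law is that of q together with
    n ∘ m = id.  The first formula for u follows from the second by the
    compatibility of m with the multiplication of T. *)

Section Action.
Variables (C : Category) (S T : Monad C) (L : Sesquilaw S T).

Let m := sq_m L.
Let n := sq_n L.

Lemma TS_mult_mu_last (X : C) :
  TS_mult_fun m X = fmap T (mu S X) ∘ mu T (S (S X)) ∘ fmap T (m (S X)).
Proof. by rewrite /TS_mult_fun (mu_nat T (mu S X)). Qed.

(** The compatibility of n with the multiplication of S carries n past that
    multiplication; [sq_mult] then carries it past the multiplication of T and
    absorbs the law m inside q. *)
Lemma adl_TS_mult_factor (X : C) :
  n X ∘ TS_mult_fun m X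
  = mu S (T X) ∘ fmap S (n X) ∘ fmap S (mu T (S X)) ∘ n (T (S X)).
Proof.
rewrite TS_mult_mu_last !comp_assoc adl_muS -!comp_assoc.
by rewrite (comp_assoc (n (S X))) sq_mult.
Qed.

Lemma absorb_idempotent (X : C) :
  n X ∘ TS_mult_fun m X ∘ m (T (S X)) ∘ n (T (S X)) = n X ∘ TS_mult_fun m X.
Proof.
rewrite adl_TS_mult_factor -!comp_assoc (comp_assoc (n _)).
by rewrite sq_section comp_idl.
Qed.

Definition action_fun (X : C) : hom (S (T (T (S X)))) (S (T X)) :=
  n X ∘ TS_mult_fun m X ∘ m (T (S X)).

Lemma action_mult_first (X : C) :
  action_fun X = n X ∘ fmap T (mu S X) ∘ m (S X) ∘ fmap S (mu T (S X)).
Proof.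
rewrite /action_fun TS_mult_mu_last -!comp_assoc.
by rewrite (dl_muT m (S X)) -!comp_assoc.
Qed.

Lemma action_nat (X Y : C) (f : hom X Y) :
  action_fun Y ∘ fmap S (fmap T (fmap T (fmap S f)))
  = fmap S (fmap T f) ∘ action_fun X.
Proof.
rewrite /action_fun -(comp_assoc (n Y ∘ _)) (dl_nat m (fmap T (fmap S f))).
rewrite (comp_assoc (n Y ∘ _)) -(comp_assoc (n Y)) TS_mult_nat.
by rewrite (comp_assoc (n Y)) (adl_nat n f) -!comp_assoc.
Qed.

Lemma action_unit (X : C) :
  action_fun X ∘ fmap S (fmap T (TS_unit_fun S T X)) = idm (S (T X)).
Proof.
rewrite /action_fun -(comp_assoc (n X ∘ _)) (dl_nat m (TS_unit_fun S T X)).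
rewrite (comp_assoc (n X ∘ _)) -(comp_assoc (n X)) TS_unit_r.
by rewrite comp_idr sq_section.
Qed.

Lemma action_mult (X : C) :
  action_fun X ∘ fmap S (fmap T (TS_mult_fun m X))
  = action_fun X ∘ action_fun (T (S X)).
Proof.
rewrite /action_fun -(comp_assoc (n X ∘ _)) (dl_nat m (TS_mult_fun m X)).
rewrite (comp_assoc (n X ∘ _)) -(comp_assoc (n X)) TS_assoc (comp_assoc (n X)).
rewrite (comp_assoc _ _ (m (T (S (T (S X)))))).
by rewrite (comp_assoc _ (n (T (S X)))) absorb_idempotent.
Qed.

Definition action_nt :
  NatTrans (sesquilaw_magmad L ∘F sesquilaw_monad L) (sesquilaw_magmad L) :=
  @Build_NatTrans C C (sesquilaw_magmad L ∘F sesquilaw_monad L)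
    (sesquilaw_magmad L) action_fun action_nat.

Definition sesquilaw_action :
  RightAction (sesquilaw_monad L) (sesquilaw_magmad L) :=
  @Build_RightAction C (sesquilaw_monad L) (sesquilaw_magmad L)
    action_nt action_unit action_mult.

End Action.

Theorem theorem4p3 (C : Category) (S T : Monad C) (L : Sesquilaw S T) :
  exists u : RightAction (sesquilaw_monad L) (sesquilaw_magmad L),
    (forall X : C,
       u X = sq_n L X ∘ fmap T (mu S X) ∘ sq_m L (S X) ∘ fmap S (mu T (S X)))
    /\
    (forall X : C,
       u X = sq_n L X ∘ mu T (S X) ∘ fmap T (fmap T (mu S X))
             ∘ fmap T (sq_m L (S X)) ∘ sq_m L (T (S X))).
Proof.
exists (sesquilaw_action C S T L); split=> X.
  exact: action_mult_first.
by rewrite /= /action_fun /TS_mult_fun !comp_assoc.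
Qed.
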